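(* Let $E_0,E_1,E_2,\dots$ be compact metric spaces and, for each $l\ge 1$, let $Q_l$ be a sub-probability transition function from $E_l$ to $E_{l-1}$. For $x,\tilde x\in E_l$ let $$\epsilon_l(x,\tilde x):=\int_{E_{l-1}}\Big(\frac{dQ_l(x,\cdot)}{d(Q_l(x,\cdot)+Q_l(\tilde x,\cdot))}(y)\wedge\frac{dQ_l(\tilde x,\cdot)}{d(Q_l(x,\cdot)+Q_l(\tilde x,\cdot))}(y)\Big)\,\big(Q_l(x,dy)+Q_l(\tilde x,dy)\big).$$ Assume that $\sup_{x\in E_l}Q_l(x,E_{l-1})>0$ for all $l\ge1$, and that there exist $c_0>0$ and $\epsilon_0>0$ such that (i) $\inf_{x\in E_k}Q_k\cdots Q_1 1(x)\ \ge\ c_0\,\sup_{x\in E_k}Q_k\cdots Q_1 1(x)$ for all $k\ge1$; (ii) $\inf_{k\ge1}\ \inf_{x,\tilde x\in E_k}\epsilon_k(x,\tilde x)\ge\epsilon_0$. Then $\inf_{x\in E_k}Q_k\cdots Q_1 1(x)>0$ for all $k\ge1$, and for every continuous $f:E_0\to\mathbb R$ there is a constant $C(f)$ such that, for every sequence of probability measures $\mu_k\in\mathcal P(E_k)$, $k\ge1$, $$\lim_{k\to\infty}\frac{\int Q_kQ_{k-1}\cdots Q_1f(x)\,\mu_k(dx)}{\int Q_kQ_{k-1}\cdots Q_1 1(x)\,\mu_k(dx)}=C(f),$$ where $C(f)$ does not depend on the sequence $\{\mu_k\}$.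
   Context: A sub-probability transition function $Q$ from a compact metric space $E$ to a compact metric space $E'$ is a family of finite Borel measures $Q(x,\cdot)$ on $E'$, $x\in E$, with $Q(x,E')\le1$, such that $x\mapsto Q(x,C)$ is Borel measurable for each Borel $C\subseteq E'$. The same symbol denotes the integral operator $Qf(x)=\int_{E'}f(y)Q(x,dy)$. $1$ denotes the constant function equal to one, $\mathcal P(E)$ the set of Borel probability measures on $E$, and $a\wedge b=\min(a,b)$. *)

(* Defs.v *)
From HB Require Import structures.
From mathcomp Require Import all_boot all_order all_algebra.
From mathcomp Require Import all_classical all_reals all_analysis measurable_realfun.

Set Implicit Arguments.
Unset Strict Implicit.
Unset Printing Implicit Defensive.

Import Order.TTheory GRing.Theory Num.Theory.
Import numFieldNormedType.Exports.

Local Open Scope classical_set_scope.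
Local Open Scope ring_scope.
Local Open Scope ereal_scope.
Local Open Scope charge_scope.

(* [measurableType] only accepts pointed carriers, hence this join. *)
#[short(type="pmetricType")]
HB.structure Definition PointedMetric (K : numDomainType) :=
  { M of Pointed M & Metric K M }.

Notation borel T := (g_sigma_algebraType (@open T)).

Section measure_add_finite.
Context d (Y : measurableType d) (R : realType).
Variables mu nu : {finite_measure set Y -> \bar R}.

HB.instance Definition _ := Measure.on (measure_add mu nu).

Let measure_add_fin : fin_num_fun (measure_add mu nu).
Proof.
by move=> A mA; rewrite measure_addE fin_numD !fin_num_measure.
Qed.

HB.instance Definition _ :=
  Measure_isFinite.Build _ _ _ (measure_add mu nu) measure_add_fin.
End measure_add_finite.

Section kernel_measure.
Context d d' (X : measurableType d) (Y : measurableType d') (R : realType).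
Variables (Q : R.-spker X ~> Y) (x : X).

(* The measure Q(x, .), packaged as a finite measure: the coercion from kernels
   only provides a {measure _}, which has no Radon-Nikodym derivative. *)
Definition kernel_measure : set Y -> \bar R := Q x.

HB.instance Definition _ := Measure.on kernel_measure.

Let kernel_measure_fin : fin_num_fun kernel_measure.
Proof.
apply: lty_fin_num_fun.
by rewrite /kernel_measure (le_lt_trans (sprob_kernel_le1 Q x)) ?ltry.
Qed.

HB.instance Definition _ :=
  Measure_isFinite.Build _ _ _ kernel_measure kernel_measure_fin.
End kernel_measure.

Definition overlap d d' (X : measurableType d) (Y : measurableType d')
    (R : realType) (Q : R.-spker X ~> Y) (x x' : X) : \bar R :=
  let mu := kernel_measure Q x in
  let mu' := kernel_measure Q x' in
  let nu := measure_add mu mu' in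
  \int[nu]_y mine (('d (charge_of_finite_measure mu) '/d nu) y)
                  (('d (charge_of_finite_measure mu') '/d nu) y).

Definition kernel_op d d' (X : measurableType d) (Y : measurableType d')
    (R : realType) (Q : R.-spker X ~> Y) (f : Y -> R) (x : X) : R :=
  (\int[Q x]_y f y)%R.

(* [Q l] is the transition function Q_(l+1) from E_(l+1) to E_l, and
   [iter_op Q f k] is Q_k ... Q_1 f. *)
Fixpoint iter_op (R : realType) (E : nat -> pmetricType R)
    (Q : forall l, R.-spker (borel (E l.+1)) ~> borel (E l))
    (f : E 0%N -> R) (k : nat) {struct k} : E k -> R :=
  match k with
  | 0%N => f
  | l.+1 => kernel_op (Q l) (@iter_op R E Q f l)
  end.
Arguments iter_op {R E} Q f k x.

(* Main.v *)
Require Import Defs.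
From mathcomp Require Import all_boot all_order all_algebra.
From mathcomp Require Import all_classical all_reals all_analysis measurable_realfun.
From mathcomp Require Import ring lra.

(** Write [h_k = Q_k ... Q_1 1], [g_k = Q_k ... Q_1 f] and [r_k = g_k / h_k].
    If [a <= r_k <= b], then for [x, x'] in [E_(k+1)] both [Q (g_k - a h_k) x]
    and [Q (b h_k - g_k) x'] are integrals of nonnegative functions whose sum is
    [(b - a) h_k], so together they are at least
    [(b - a) * inf h_k * overlap x x'].  Since [h_(k+1) <= sup h_k] and
    [inf h_k >= c0 sup h_k], dividing by [h_(k+1)] gives
    [r_(k+1) x' - r_(k+1) x <= (1 - c0 eps0) (b - a)].  The ranges of the [r_k]
    are thus contained in nested intervals shrinking geometrically to a point
    [C f]; the quotient of the integrals against [mu_k] lies in the [k]-th one. *)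

Set Implicit Arguments.
Unset Strict Implicit.
Unset Printing Implicit Defensive.

Import Order.TTheory GRing.Theory Num.Theory.
Import numFieldNormedType.Exports.

Local Open Scope classical_set_scope.
Local Open Scope ring_scope.
Local Open Scope ereal_scope.
Local Open Scope charge_scope.

(** * Bounded measurable functions *)

(** This class replaces the continuous functions along the iteration: [kernel_op] preserves it,
    whereas the kernels need not preserve continuity. *)
Definition bounded_measurable d (T : measurableType d) (R : realType)
    (f : T -> R) :=
  measurable_fun [set: T] f /\ exists M : R, forall x, (`|f x| <= M)%R.

Lemma bounded_measurable_integrable d (T : measurableType d) (R : realType)
    (mu : {finite_measure set T -> \bar R}) (f : T -> R) :
  bounded_measurable f -> mu.-integrable [set: T] (EFin \o f).
Proof.
move=> [mf [M fM]]; apply: measurable_bounded_integrable => //.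
- by rewrite ltey_eq fin_num_measure.
- exists M; split; first exact: num_real.
  by move=> x Mx t _ /=; apply: (le_trans (fM t)); exact: ltW.
Qed.

Lemma bounded_measurable_cst d (T : measurableType d) (R : realType) (c : R) :
  bounded_measurable (cst c : T -> R).
Proof. by split; [exact: measurable_cst|exists `|c|%R]. Qed.

Lemma bounded_measurableZ d (T : measurableType d) (R : realType)
    (c : R) (f : T -> R) :
  bounded_measurable f -> bounded_measurable (fun x => c * f x)%R.
Proof.
move=> [mf [M fM]]; split; first exact: measurable_funM.
by exists (`|c| * M)%R => x; rewrite normrM ler_wpM2l.
Qed.

Lemma bounded_measurable_comb d (T : measurableType d) (R : realType)
    (a b : R) (f g : T -> R) :
  bounded_measurable f -> bounded_measurable g ->
  bounded_measurable (fun x => a * f x + b * g x)%R.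
Proof.
move=> /(bounded_measurableZ a)[mf [M fM]] /(bounded_measurableZ b)[mg [N gN]].
split; first exact: measurable_funD.
by exists (M + N)%R => x; rewrite (le_trans (ler_normD _ _))// lerD.
Qed.

Lemma continuous_bounded_measurable (R : realType) (M : pmetricType R)
    (f : M -> R) : compact [set: M] -> continuous f ->
  bounded_measurable (f : borel M -> R).
Proof.
move=> cM cf; split.
  apply: (measurability _ (RGenOpens.measurableE R)).
  move=> _ [_ [a [b ->] <-]]; rewrite setTI.
  apply: sub_sigma_algebra.
  by move/continuousP: cf; apply; exact: interval_open.
have : compact (f @` setT).
  by apply: continuous_compact => //; exact: continuous_subspaceT.
(* Boundedness of the image provides a bound by every real strictly above [N], hence [N + 1]. *)
move=> /compact_bounded[N [_ fN]]; exists (N + 1)%R => x.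
by apply: fN; [rewrite ltrDl|exists x].
Qed.

(** * Linearity, monotonicity and measurability of kernel operators *)

Section kernel_op_theory.
Context d d' (X : measurableType d) (Y : measurableType d') (R : realType).
Variable Q : R.-spker X ~> Y.
Implicit Types f g h : Y -> R.

Lemma EFin_kernel_op f x : bounded_measurable f ->
  (kernel_op Q f x)%:E = \int[Q x]_y (f y)%:E.
Proof.
move=> bf; rewrite /kernel_op /Rintegral fineK//.
exact/(integrable_fin_num measurableT)/
  (bounded_measurable_integrable (kernel_measure Q x) bf).
Qed.

Lemma kernel_opZ (c : R) f x : bounded_measurable f ->
  kernel_op Q (fun y => c * f y)%R x = (c * kernel_op Q f x)%R.
Proof.
move=> bf; apply: (@RintegralZl _ _ _ (kernel_measure Q x)) => //.
exact: bounded_measurable_integrable.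
Qed.

Lemma kernel_op_comb (a b : R) f g x :
  bounded_measurable f -> bounded_measurable g ->
  kernel_op Q (fun y => a * f y + b * g y)%R x =
  (a * kernel_op Q f x + b * kernel_op Q g x)%R.
Proof.
move=> bf bg; rewrite -!kernel_opZ//.
by apply: (@RintegralD _ _ _ (kernel_measure Q x)) => //;
  exact/bounded_measurable_integrable/bounded_measurableZ.
Qed.

Lemma le_kernel_op f g x : bounded_measurable f -> bounded_measurable g ->
  (forall y, f y <= g y)%R -> (kernel_op Q f x <= kernel_op Q g x)%R.
Proof.
move=> bf bg fg; apply: (@le_Rintegral _ _ _ (kernel_measure Q x)) => //;
  exact: bounded_measurable_integrable.
Qed.

Lemma kernel_op_cst (c : R) x :
  kernel_op Q (cst c) x = (c * fine (Q x setT))%R.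
Proof. exact: (@Rintegral_cst _ _ _ (kernel_measure Q x)). Qed.

Lemma fine_kernel_le1 x : (0 <= fine (Q x setT) <= 1)%R.
Proof.
rewrite fine_ge0//= -lee_fin fineK ?sprob_kernel_le1//.
exact: (@fin_num_measure _ _ _ (kernel_measure Q x)).
Qed.

(** The mass of [Q x] may be less than one, so a constant upper bound is kept only when it is
    nonnegative. *)
Lemma kernel_op_le (c : R) f x : (0 <= c)%R -> bounded_measurable f ->
  (forall y, f y <= c)%R -> (kernel_op Q f x <= c)%R.
Proof.
move=> c0 bf fc.
apply: (@le_trans _ _ (kernel_op Q (cst c) x)).
  by apply: le_kernel_op => //; exact: bounded_measurable_cst.
by rewrite kernel_op_cst ler_piMr//; case/andP: (fine_kernel_le1 x).
Qed.

Lemma bounded_measurable_kernel_op f :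
  bounded_measurable f -> bounded_measurable (kernel_op Q f).
Proof.
move=> bf; have [mf [M fM]] := bf; split; last first.
  exists `|M|%R => x; rewrite ler_norml; apply/andP; split; last first.
    by apply: kernel_op_le => // y; rewrite (le_trans (ler_norm _))// (le_trans (fM y))// ler_norm.
  (* The lower bound is the upper bound for [-1 * f]. *)
  rewrite lerNl -mulN1r -kernel_opZ//; apply: kernel_op_le => //.
    exact: bounded_measurableZ.
  move=> y; rewrite mulN1r (le_trans (ler_norm _))// normrN.
  by rewrite (le_trans (fM y))// ler_norm.
(* Measurability in [x] is a fact about integrals of nonnegative functions, so the integrand is
   split into its positive and negative parts. *)
rewrite (_ : kernel_op Q f = fine \o
    (fun x => \int[Q x]_y (EFin \o f)^\+ y - \int[Q x]_y (EFin \o f)^\- y)).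
  apply: measurableT_comp => //; apply: emeasurable_funB;
    apply: (@measurable_fun_integral_kernel _ _ X Y R (fun x => Q x)) => //.
  + by move=> U mU; exact: measurable_kernel.
  + exact/measurable_funepos/measurable_EFinP.
  + by move=> U mU; exact: measurable_kernel.
  + exact/measurable_funeneg/measurable_EFinP.
by apply/funext => x; rewrite /kernel_op /Rintegral integralE.
Qed.

End kernel_op_theory.

(** * The overlap bound and the one-step contraction of ratios *)

(** With densities [p], [p'] of [mu], [mu'] with respect to [nu], the right side is the integral of
    [f * p + f' * p'], which is at least [(f + f') * mine p p'], hence at least [c * mine p p']. *)
Lemma overlap_le_integralD d (Y : measurableType d) (R : realType)
    (mu mu' : {finite_measure set Y -> \bar R})
    (nu : {sigma_finite_measure set Y -> \bar R}) (c : \bar R)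
    (f f' : Y -> \bar R) :
  mu `<< nu -> mu' `<< nu -> 0 <= c ->
  (forall y, 0 <= f y) -> (forall y, 0 <= f' y) ->
  measurable_fun setT f -> measurable_fun setT f' ->
  (forall y, c <= f y + f' y) ->
  c * \int[nu]_y mine (('d (charge_of_finite_measure mu) '/d nu) y)
                      (('d (charge_of_finite_measure mu') '/d nu) y) <=
  \int[mu]_y f y + \int[mu']_y f' y.
Proof.
move=> munu mu'nu c0 f0 f'0 mf mf' cff'.
(* This version of the density is nonnegative everywhere, unlike ['d mu '/d nu]
   which is so only almost everywhere. *)
pose p := Radon_Nikodym_SigmaFinite.f mu nu.
pose p' := Radon_Nikodym_SigmaFinite.f mu' nu.
have p0 y : 0 <= p y by exact: Radon_Nikodym_SigmaFinite.f_ge0.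
have p'0 y : 0 <= p' y by exact: Radon_Nikodym_SigmaFinite.f_ge0.
have mp : measurable_fun setT p.
  exact: measurable_int (Radon_Nikodym_SigmaFinite.f_integrable munu).
have mp' : measurable_fun setT p'.
  exact: measurable_int (Radon_Nikodym_SigmaFinite.f_integrable mu'nu).
have pp'0 y : 0 <= mine (p y) (p' y) by rewrite le_min p0 p'0.
rewrite (_ : \int[nu]_y mine _ _ = \int[nu]_y mine (p y) (p' y)); last first.
  apply: ae_eq_integral => //.
  - by apply: measurable_mine; apply: measurable_int;
      exact: Radon_Nikodym_integrable.
  - exact: measurable_mine.
  - have e := ae_eq_Radon_Nikodym_SigmaFinite munu measurableT.
    have e' := ae_eq_Radon_Nikodym_SigmaFinite mu'nu measurableT.
    by move: e e'; apply: filterS2 => y + + _ => /(_ I) <- /(_ I) <-.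
rewrite -ge0_integralZl//; last exact: measurable_mine.
rewrite -(Radon_Nikodym_SigmaFinite.change_of_variables munu)//.
rewrite -(Radon_Nikodym_SigmaFinite.change_of_variables mu'nu)//.
rewrite -ge0_integralD//; last 4 first.
- by move=> y _; exact: mule_ge0.
- exact: emeasurable_funM.
- by move=> y _; exact: mule_ge0.
- exact: emeasurable_funM.
apply: ge0_le_integral => //.
- by move=> y _; exact: mule_ge0.
- by apply: emeasurable_funM => //; exact: measurable_mine.
- by apply: emeasurable_funD; exact: emeasurable_funM.
move=> y _.
apply: (@le_trans _ _ ((f y + f' y) * mine (p y) (p' y))).
  exact: lee_wpmul2r.
rewrite ge0_muleDl//; apply: leeD; apply: lee_wpmul2l => //.
- by rewrite ge_min lexx.
- by rewrite ge_min lexx orbT.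
Qed.

Lemma overlap_le_kernel_op d d' (X : measurableType d) (Y : measurableType d')
    (R : realType) (Q : R.-spker X ~> Y) (x x' : X) (c : R) (f f' : Y -> R) :
  (0 <= c)%R -> bounded_measurable f -> bounded_measurable f' ->
  (forall y, 0 <= f y)%R -> (forall y, 0 <= f' y)%R ->
  (forall y, c <= f y + f' y)%R ->
  c%:E * overlap Q x x' <= (kernel_op Q f x + kernel_op Q f' x')%:E.
Proof.
move=> c0 bf bf' f0 f'0 cff'.
rewrite EFinD !EFin_kernel_op//.
apply: (@overlap_le_integralD _ Y R (kernel_measure Q x) (kernel_measure Q x')
  (measure_add (kernel_measure Q x) (kernel_measure Q x'))) => //.
(* A set that is null for the sum is null for each summand. *)
- apply/null_content_dominatesP => A mA.
  rewrite [X in X = _ -> _]measure_addE => /eqP.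
  by rewrite padde_eq0// => /andP[/eqP].
- apply/null_content_dominatesP => A mA.
  rewrite [X in X = _ -> _]measure_addE => /eqP.
  by rewrite padde_eq0// => /andP[_ /eqP].
- by apply/measurable_EFinP; case: bf.
- by apply/measurable_EFinP; case: bf'.
Qed.

(** In the application [S] is the supremum of [h], and [c], [eps] are [c0], [eps0]. *)
Lemma kernel_op_ratio_contraction d d' (X : measurableType d)
    (Y : measurableType d') (R : realType) (Q : R.-spker X ~> Y) (x x' : X)
    (S c eps a b : R) (h g : Y -> R) :
  (0 <= c)%R -> (0 <= eps)%R -> (0 < S)%R -> (a <= b)%R ->
  bounded_measurable h -> bounded_measurable g ->
  (forall y, c * S <= h y <= S)%R ->
  (forall y, a * h y <= g y <= b * h y)%R ->
  (0 < kernel_op Q h x)%R -> (0 < kernel_op Q h x')%R ->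
  eps%:E <= overlap Q x x' ->
  (kernel_op Q g x' / kernel_op Q h x' - kernel_op Q g x / kernel_op Q h x <=
   (1 - c * eps) * (b - a))%R.
Proof.
move=> c0 e0 S0 ab bh bg hS gh hx hx' ovl.
(* The coefficients [1] and [- 1] are kept explicit to match the form of [kernel_op_comb]. *)
pose f y := (1 * g y + (- a) * h y)%R.
pose f' y := (b * h y + (- 1) * g y)%R.
have bf : bounded_measurable f by exact: bounded_measurable_comb.
have bf' : bounded_measurable f' by exact: bounded_measurable_comb.
have f0 y : (0 <= f y)%R by rewrite /f; have /andP[] := gh y; lra.
have f'0 y : (0 <= f' y)%R by rewrite /f'; have /andP[] := gh y; lra.
have ff' y : ((b - a) * (c * S) <= f y + f' y)%R.
  rewrite /f /f' (_ : (_ + _ + _ = (b - a) * h y)%R); last by ring.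
  by rewrite ler_wpM2l ?subr_ge0//; case/andP: (hS y).
have d0 : (0 <= (b - a) * (c * S))%R.
  by rewrite mulr_ge0 ?subr_ge0// mulr_ge0// ltW.
have key : ((b - a) * (c * S) * eps <= kernel_op Q f x + kernel_op Q f' x')%R.
  rewrite -lee_fin; apply: (le_trans _ (overlap_le_kernel_op Q x x' d0 bf bf' f0 f'0 ff')).
  by rewrite EFinM lee_wpmul2l.
have hxS z : (kernel_op Q h z <= S)%R.
  by apply: kernel_op_le => //; [exact: ltW|move=> y; case/andP: (hS y)].
have Qf0 : (0 <= kernel_op Q f x)%R by exact: Rintegral_ge0.
have Qf'0 : (0 <= kernel_op Q f' x')%R by exact: Rintegral_ge0.
(* Enlarging both denominators to the common [S] lets [key] bound the sum of the two quotients. *)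
have ltS u z : (0 <= u -> 0 < kernel_op Q h z -> u / S <= u / kernel_op Q h z)%R.
  by move=> u0 hz; rewrite ler_wpM2l// lef_pV2 ?posrE.
have sumS : ((b - a) * c * eps <=
    kernel_op Q f x / kernel_op Q h x + kernel_op Q f' x' / kernel_op Q h x')%R.
  apply: le_trans (lerD (ltS _ _ Qf0 hx) (ltS _ _ Qf'0 hx')).
  rewrite -mulrDl ler_pdivlMr//; apply: le_trans key.
  by rewrite le_eqVlt; apply/orP; left; apply/eqP; ring.
(* The two quotients are the ratio at [x] minus [a] and [b] minus the ratio at [x'], so their sum is
   [b - a] minus the difference to be bounded. *)
move: sumS; rewrite !kernel_op_comb// !mulrDl.
rewrite -!mulrA !divff ?gt_eqF//.
lra.
Qed.

(** * Shrinking intervals and quotients of integrals *)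

(** [L] converges, being monotone and bounded by [U 0]; the widths decay geometrically, so [U] has
    the same limit. *)
Lemma contracting_intervals_cvg (R : realType) (L U : R ^nat) (q : R) :
  (q < 1)%R -> (forall k, L k <= U k)%R ->
  (forall k, L k <= L k.+1)%R -> (forall k, U k.+1 <= U k)%R ->
  (forall k, U k.+1 - L k.+1 <= q * (U k - L k))%R ->
  exists C : R, L @ \oo --> C /\ U @ \oo --> C.
Proof.
move=> q1 LU Lnd Uni ctr.
(* No sign is assumed on [q]; iterating the width bound requires a nonnegative ratio. *)
pose p := Num.max q 0%R.
have p0 : (0 <= p)%R by rewrite le_max lexx orbT.
have p1 : (p < 1)%R by rewrite gt_max q1 ltr01.
have LUp k : (U k - L k <= geometric (U 0%N - L 0%N) p k)%R.
  elim: k => [|k IH]; first by rewrite /geometric/= expr0 mulr1.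
  rewrite /geometric/= exprSr mulrA mulrC; apply: le_trans (ctr k) _.
  rewrite (@le_trans _ _ (p * (U k - L k))%R)//; last exact: ler_wpM2l.
  by rewrite ler_wpM2r ?subr_ge0// le_max lexx.
have LU0 : (U \- L)%R @ \oo --> (0 : R)%R.
  apply: (@squeeze_cvgr _ _ _ _ (cst 0%R) (geometric (U 0%N - L 0%N) p)).
  - by apply: nearW => k; rewrite /= subr_ge0 LU LUp.
  - exact: cvg_cst.
  - by apply: cvg_geometric; rewrite ger0_norm.
have ndL : nondecreasing_seq L by exact/nondecreasing_seqP.
have niU : nonincreasing_seq U by exact/nonincreasing_seqP.
have cL : cvgn L.
  apply: nondecreasing_is_cvgn => //; exists (U 0%N) => _ [k _ <-].
  by apply: le_trans (LU k) _; exact: niU.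
exists (limn L); split => //.
rewrite (_ : U = L \+ (U \- L))%R; last by apply/funext => k /=; ring.
by rewrite -[X in _ --> X]addr0; apply: cvgD.
Qed.

(** Integrate [a * h <= g <= b * h]; the uniform bound [m] keeps the integral of [h] positive. *)
Lemma Rintegral_ratio_bounds d (T : measurableType d) (R : realType)
    (mu : probability T R) (g h : T -> R) (m a b : R) : (0 < m)%R ->
  bounded_measurable g -> bounded_measurable h ->
  (forall x, m <= h x)%R -> (forall x, a <= g x / h x <= b)%R ->
  (a <= (\int[mu]_x g x) / (\int[mu]_x h x) <= b)%R.
Proof.
move=> m0 bg bh mh gh.
have Ig := bounded_measurable_integrable mu bg.
have Ih := bounded_measurable_integrable mu bh.
have h0 x : (0 < h x)%R by exact: lt_le_trans (mh x).
have Ih0 : (0 < \int[mu]_x h x)%R.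
  apply: lt_le_trans m0 _.
  have <- : (\int[mu]_x (cst m x) = m)%R.
    by rewrite Rintegral_cst// [X in fine X](probability_setT mu) mulr1.
  apply: le_Rintegral => //.
  exact/bounded_measurable_integrable/bounded_measurable_cst.
have IZ c : mu.-integrable setT (EFin \o (fun x => c * h x)%R).
  exact/bounded_measurable_integrable/bounded_measurableZ.
rewrite ler_pdivlMr// ler_pdivrMr// -!RintegralZl//.
apply/andP; split; apply: le_Rintegral => // x _;
  have /andP[] := gh x; by rewrite ler_pdivlMr// ler_pdivrMr.
Qed.

(** * Iterates of the kernels and convergence of their ratios *)

Section iterated_operators.
Context (R : realType) (E : nat -> pmetricType R).
Variable Q : forall l, R.-spker (borel (E l.+1)) ~> borel (E l).

Lemma bounded_measurable_iter_op (f : E 0%N -> R) :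
  bounded_measurable (f : borel (E 0%N) -> R) ->
  forall k, bounded_measurable (iter_op Q f k : borel (E k) -> R).
Proof. by move=> bf; elim=> //= k IH; exact: bounded_measurable_kernel_op. Qed.

Lemma bounded_measurable_iter_op1 k :
  bounded_measurable (iter_op Q (cst 1%R) k : borel (E k) -> R).
Proof.
by apply: bounded_measurable_iter_op; exact: bounded_measurable_cst.
Qed.

Variable c0 : R.
Hypothesis c0_gt0 : (0 < c0)%R.
Hypothesis ratio_bound : forall k,
  ereal_inf [set (iter_op Q (cst 1) k.+1 x)%:E | x in setT] >=
  c0%:E * ereal_sup [set (iter_op Q (cst 1) k.+1 x)%:E | x in setT].

Lemma iter_op1_ratio_bound k (x x' : E k.+1) :
  (c0 * iter_op Q (cst 1) k.+1 x <= iter_op Q (cst 1) k.+1 x')%R.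
Proof.
rewrite -lee_fin EFinM.
apply: (@le_trans _ _ (ereal_inf [set (iter_op Q (cst 1%R) k.+1 x)%:E | x in setT])).
  apply: le_trans (ratio_bound k); rewrite lee_pmul2l//.
  by apply: ereal_sup_ubound; exists x.
by apply: ereal_inf_lbound; exists x'.
Qed.

Hypothesis Qpos : forall l, 0 < ereal_sup [set Q l x setT | x in setT].

(** By induction: at a point [x] where [Q k x] has positive mass, the next iterate is at least [m]
    times that mass, and [ratio_bound] spreads this to all points at the cost of the factor [c0]. *)
Lemma iter_op1_lower_bound k :
  exists2 m : R, (0 < m)%R & forall x, (m <= iter_op Q (cst 1) k x)%R.
Proof.
elim: k => [|k [m m0 mh]]; first by exists 1%R.
have [_ [x _ <-] Qx] := ereal_sup_gt (Qpos k).
exists (c0 * (m * fine (Q k x setT)))%R.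
  rewrite !mulr_gt0// fine_gt0// Qx.
  by rewrite (le_lt_trans (sprob_kernel_le1 (Q k) x))// ltry.
move=> x'; apply: le_trans (iter_op1_ratio_bound x x').
rewrite ler_pM2l//= -kernel_op_cst; apply: le_kernel_op => //.
  exact: bounded_measurable_cst.
exact: bounded_measurable_iter_op1.
Qed.

Variable eps0 : R.
Hypothesis eps0_gt0 : (0 < eps0)%R.
Hypothesis overlap_ge : forall k x x', eps0%:E <= overlap (Q k) x x'.

(** The index is shifted: [r f k] lives on [E k.+1], as does the measure [mu k]. *)
Let r f k x := (iter_op Q f k.+1 x / iter_op Q (cst 1) k.+1 x)%R.
Arguments r : clear implicits.

(** This makes the real-valued [inf] and [sup] of the range of [r f k] genuine bounds. *)
Lemma iter_op_ratio_bounded (f : E 0%N -> R) k :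
  bounded_measurable (f : borel (E 0%N) -> R) ->
  exists M : R, forall x, (`|r f k x| <= M)%R.
Proof.
move=> bf; have [m m0 mh] := iter_op1_lower_bound k.+1.
have [_ [M gM]] := bounded_measurable_iter_op bf k.+1.
exists (M / m)%R => x; rewrite /r normrM normfV.
have h0 := lt_le_trans m0 (mh x).
by rewrite (gtr0_norm h0) ler_pM ?invr_ge0 ?lef_pV2 ?posrE// ?ltW//; exact: gM.
Qed.

(** The first two bounds, from monotonicity of the operator, nest the intervals; the third shrinks
    them. *)
Lemma iter_op_ratio_contraction (f : E 0%N -> R) k (a b : R) x x' :
  bounded_measurable (f : borel (E 0%N) -> R) ->
  (forall y, a <= r f k y <= b)%R ->
  [/\ (a <= r f k.+1 x)%R, (r f k.+1 x <= b)%R &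
      (r f k.+1 x' - r f k.+1 x <= (1 - c0 * eps0) * (b - a))%R].
Proof.
move=> bf rab.
set h := iter_op Q (cst 1%R) k.+1; set g := iter_op Q f k.+1.
have bh : bounded_measurable (h : borel (E k.+1) -> R).
  exact: bounded_measurable_iter_op1.
have bg : bounded_measurable (g : borel (E k.+1) -> R).
  exact: bounded_measurable_iter_op.
have [m m0 mh] := iter_op1_lower_bound k.+1.
have [m' m'0 mh'] := iter_op1_lower_bound k.+2.
have h0 y : (0 < h y)%R by exact: lt_le_trans (mh y).
have h'0 y : (0 < kernel_op (Q k.+1) h y)%R by exact: lt_le_trans (mh' y).
have gh y : (a * h y <= g y <= b * h y)%R.
  by have := rab y; rewrite /r ler_pdivlMr ?ler_pdivrMr.
have supP : has_sup (range h).
  split; first by exists (h point), point.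
  by case: bh => _ [M hM]; exists M => _ [y _ <-]; rewrite (le_trans (ler_norm _)).
have hS y : (c0 * sup (range h) <= h y <= sup (range h))%R.
  apply/andP; split; last by apply: ub_le_sup; [case: supP|exists y].
  (* Dividing by [c0] turns the claim into [h y / c0] being an upper bound of the range of [h],
     which is checked pointwise. *)
  rewrite mulrC -ler_pdivlMr//; apply: ge_sup; first by case: supP.
  move=> _ [z _ <-]; rewrite ler_pdivlMr// mulrC.
  exact: iter_op1_ratio_bound.
have ab : (a <= b)%R by have /andP[] := rab point; exact: le_trans.
have bZ c := bounded_measurableZ c bh.
split.
- rewrite /r ler_pdivlMr; last exact: h'0.
  rewrite -(kernel_opZ _ _ _ bh); apply: le_kernel_op => //.
  by move=> y; case/andP: (gh y).
- rewrite /r ler_pdivrMr; last exact: h'0.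
  rewrite -(kernel_opZ _ _ _ bh); apply: le_kernel_op => //.
  by move=> y; case/andP: (gh y).
- have S0 : (0 < sup (range h))%R.
    by apply: lt_le_trans (h0 point) _; case/andP: (hS point).
  apply: (kernel_op_ratio_contraction _ _ S0 ab bh bg hS gh) => //; exact: ltW.
Qed.

Lemma iter_op_ratio_cvg (f : E 0%N -> R) :
  bounded_measurable (f : borel (E 0%N) -> R) ->
  exists C : R, forall mu : forall k, probability (borel (E k.+1)) R,
    ((\int[mu k]_x iter_op Q f k.+1 x) /
     (\int[mu k]_x iter_op Q (cst 1) k.+1 x))%R @[k --> \oo] --> C.
Proof.
move=> bf.
pose L k := inf (range (r f k)); pose U k := sup (range (r f k)).
have ne k : range (r f k) !=set0 by exists (r f k point), point.
have LrU k y : (L k <= r f k y <= U k)%R.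
  have [M rM] := iter_op_ratio_bounded k bf.
  apply/andP; split.
  - apply: ge_inf; last by exists y.
    by exists (- M)%R => _ [z _ <-]; exact: lerNnormlW.
  - apply: ub_le_sup; last by exists y.
    by exists M => _ [z _ <-]; rewrite (le_trans (ler_norm _)).
have step k x x' := iter_op_ratio_contraction x x' bf (LrU k).
have [|||||C [LC UC]] := @contracting_intervals_cvg R L U (1 - c0 * eps0).
- by rewrite ltrBlDr ltrDl mulr_gt0.
- by move=> k; have /andP[] := LrU k point; exact: le_trans.
- by move=> k; apply: lb_le_inf => // _ [x _ <-]; case: (step k x x).
- by move=> k; apply: ge_sup => // _ [x _ <-]; case: (step k x x).
(* The points [x'] and [x] vary independently, so the pairwise contraction bounds the supremum minus
   the infimum. *)
- move=> k; rewrite lerBlDr; apply: ge_sup => // _ [x' _ <-].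
  rewrite -lerBlDl; apply: lb_le_inf => // _ [x _ <-].
  by case: (step k x x') => _ _; lra.
(* [C] is fixed by [L] and [U] before [mu] is introduced, whence its independence of the
   measures. *)
exists C => mu; apply: squeeze_cvgr LC UC; apply: nearW => k.
have [m m0 mh] := iter_op1_lower_bound k.+1.
apply: (Rintegral_ratio_bounds (mu k) m0) => //.
- exact: bounded_measurable_iter_op.
- exact: bounded_measurable_iter_op1.
- exact: LrU.
Qed.

End iterated_operators.

Theorem theorem2p4 (R : realType) (E : nat -> pmetricType R)
    (Ecompact : forall l, compact [set: E l])
    (Q : forall l, R.-spker (borel (E l.+1)) ~> borel (E l))
    (Qpos : forall l, 0 < ereal_sup [set Q l x setT | x in setT])
    (c0 eps0 : R) (c0_gt0 : (0 < c0)%R) (eps0_gt0 : (0 < eps0)%R)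
    (ratio_bound : forall k,
      ereal_inf [set (iter_op Q (cst 1) k.+1 x)%:E | x in setT] >=
      c0%:E * ereal_sup [set (iter_op Q (cst 1) k.+1 x)%:E | x in setT])
    (overlap_bound :
      ereal_inf [set ereal_inf [set overlap (Q k) x x' | x in setT & x' in setT]
                | k in [set: nat]] >= eps0%:E) :
  (forall k, 0 < ereal_inf [set (iter_op Q (cst 1) k.+1 x)%:E | x in setT]) /\
  (forall f : E 0%N -> R, continuous f ->
    exists C : R, forall mu : forall k, probability (borel (E k.+1)) R,
      ((\int[mu k]_x iter_op Q f k.+1 x) /
       (\int[mu k]_x iter_op Q (cst 1) k.+1 x))%R @[k --> \oo] --> C).
Proof.
split=> [k|f cf].
  (* A uniform [m] is used because pointwise positivity alone would allow a zero infimum. *)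
  have [m m0 mh] := iter_op1_lower_bound c0_gt0 ratio_bound Qpos k.+1.
  apply: (@lt_le_trans _ _ m%:E); first by rewrite lte_fin.
  by apply: le_ereal_inf_tmp => _ [x _ <-]; rewrite lee_fin.
apply: (iter_op_ratio_cvg c0_gt0 ratio_bound Qpos eps0_gt0).
- move=> k x x'; apply: le_trans overlap_bound _.
  apply: (@le_trans _ _
    (ereal_inf [set overlap (Q k) x x' | x in setT & x' in setT])).
    by apply: ereal_inf_lbound; exists k.
  by apply: ereal_inf_lbound; exists x => //; exists x'.
- exact: continuous_bounded_measurable.
Qed.
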